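(* Let $\mathcal V$ be a symmetric monoidal closed category, let $\mathbb T=(T,\eta,\mu)$ be a $\mathcal V$-monad on a $\mathcal V$-category $\mathcal B$ equipped with a $\mathcal V$-proper $\mathcal V$-prefactorization-system $(\mathcal E,\mathcal M)$, and let $\Sigma\subseteq\Sigma_T$ be a class of morphisms of $\mathcal B$ inverted by $T$. Suppose that every morphism in $\mathcal B$ factors as a $\Sigma$-dense morphism followed by a $\Sigma$-closed $\mathcal M$-embedding. For each $B\in\mathcal B$, let $B\xrightarrow{\rho_B}KB\xrightarrow{\iota_B}TB$ be a factorization of $\eta_B:B\to TB$ with $\rho_B$ a $\Sigma$-dense morphism and $\iota_B$ a $\Sigma$-closed $\mathcal M$-embedding. Then the morphisms $\rho_B:B\to KB$ ($B\in\mathcal B$) exhibit the full sub-$\mathcal V$-category $\mathcal B_{(\mathbb T,\Sigma)}$ of $\Sigma$-complete $\mathbb T$-separated objects as a $\mathcal V$-reflective-subcategory of $\mathcal B$; that is, they are the components of the unit of a $\mathcal V$-adjunction $K\dashv J$, where $J:\mathcal B_{(\mathbb T,\Sigma)}\hookrightarrow\mathcal B$ is the inclusion.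
   Context: No limits or colimits are assumed in $\mathcal V$. A morphism of a $\mathcal V$-category $\mathcal B$ means a morphism of its underlying ordinary category. Categories are not assumed locally small. A morphism $m:B_1\to B_2$ of $\mathcal B$ is a $\mathcal V$-mono if $\mathcal B(A,m)$ is a monomorphism in $\mathcal V$ for every $A\in\mathcal B$; a $\mathcal V$-epi is a $\mathcal V$-mono in $\mathcal B^{\mathrm{op}}$. For $e:A_1\to A_2$ and $m:B_1\to B_2$ in $\mathcal B$, write $e\downarrow_{\mathcal V}m$ if the commutative square with sides $\mathcal B(A_2,m),\ \mathcal B(e,B_1),\ \mathcal B(e,B_2),\ \mathcal B(A_1,m)$ exhibits $\mathcal B(A_2,B_1)$ as the pullback of $\mathcal B(A_1,B_1)\to\mathcal B(A_1,B_2)\leftarrow\mathcal B(A_2,B_2)$ in $\mathcal V$. For classes of morphisms, $\mathcal E^{\downarrow_{\mathcal V}}=\{m\mid \forall e\in\mathcal E: e\downarrow_{\mathcal V}m\}$ and $\mathcal M^{\uparrow_{\mathcal V}}=\{e\mid\forall m\in\mathcal M: e\downarrow_{\mathcal V}m\}$. $(\mathcal E,\mathcal M)$ is a $\mathcal V$-prefactorization-system if $\mathcal E^{\downarrow_{\mathcal V}}=\mathcal M$ and $\mathcal M^{\uparrow_{\mathcal V}}=\mathcal E$; it is $\mathcal V$-proper if every morphism in $\mathcal E$ is a $\mathcal V$-epi and every morphism in $\mathcal M$ is a $\mathcal V$-mono. Morphisms in $\mathcal M$ are called $\mathcal M$-embeddings. $\Sigma_T$ is the class of all morphisms of $\mathcal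 B$ sent by $T$ to isomorphisms. An object $B$ is $\Sigma$-complete if $\mathcal B(h,B):\mathcal B(A_2,B)\to\mathcal B(A_1,B)$ is an isomorphism in $\mathcal V$ for every $h:A_1\to A_2$ in $\Sigma$. $B$ is $\mathbb T$-separated if $\eta_B:B\to TB$ is an $\mathcal M$-embedding. An $\mathcal M$-embedding is $\Sigma$-closed if it lies in $\Sigma^{\downarrow_{\mathcal V}}$. A morphism is $\Sigma$-dense if it lies in $(\Sigma^{\downarrow_{\mathcal V}}\cap\mathcal M)^{\uparrow_{\mathcal V}}$. A $\mathcal V$-reflective-subcategory of $\mathcal B$ is a full replete sub-$\mathcal V$-category whose inclusion has a left $\mathcal V$-adjoint. *)

(* Defs.v *)
From Corelib Require Import ssreflect.

Set Implicit Arguments.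
Unset Strict Implicit.
Unset Printing Implicit Defensive.

Declare Scope vcat_scope.
Delimit Scope vcat_scope with vcat.
Open Scope vcat_scope.

Reserved Notation "g ∘ f" (at level 40, left associativity).
Reserved Notation "X ⊗ Y" (at level 35, right associativity).
Reserved Notation "f ⊠ g" (at level 35, right associativity).

(* Objects and hom-sets live in two unrelated universes, so no local smallness
   is imposed. *)
Record Category := {
  Ob :> Type;
  Hom : Ob -> Ob -> Type;
  idm : forall X, Hom X X;
  comp : forall X Y Z, Hom Y Z -> Hom X Y -> Hom X Z;
  comp_idl : forall X Y (f : Hom X Y), comp (idm Y) f = f;
  comp_idr : forall X Y (f : Hom X Y), comp f (idm X) = f;
  comp_assoc : forall W X Y Z (h : Hom Y Z) (g : Hom X Y) (f : Hom W X),
    comp h (comp g f) = comp (comp h g) f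
}.

Arguments Hom {_} _ _.
Arguments idm {_} _.
Arguments comp {_ _ _ _} _ _.

Notation "g ∘ f" := (comp g f) : vcat_scope.

Definition IsIso (C : Category) (X Y : C) (f : Hom X Y) : Prop :=
  exists g : Hom Y X, g ∘ f = idm X /\ f ∘ g = idm Y.

Definition IsMono (C : Category) (X Y : C) (m : Hom X Y) : Prop :=
  forall (W : C) (a b : Hom W X), m ∘ a = m ∘ b -> a = b.

Definition IsPullback (C : Category) (P X Y Z : C)
    (p : Hom P X) (q : Hom P Y) (f : Hom X Z) (g : Hom Y Z) : Prop :=
  f ∘ p = g ∘ q /\
  forall (W : C) (a : Hom W X) (b : Hom W Y), f ∘ a = g ∘ b ->
    exists! u : Hom W P, p ∘ u = a /\ q ∘ u = b.

Record MonCategory := {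
  mon_cat :> Category;
  tens : mon_cat -> mon_cat -> mon_cat;
  tensm : forall X X' Y Y' : mon_cat,
    Hom X X' -> Hom Y Y' -> Hom (tens X Y) (tens X' Y');
  tens_id : forall X Y : mon_cat,
    tensm (idm X) (idm Y) = idm (tens X Y);
  tens_comp : forall (X X' X'' Y Y' Y'' : mon_cat)
      (f' : Hom X' X'') (f : Hom X X') (g' : Hom Y' Y'') (g : Hom Y Y'),
    tensm (f' ∘ f) (g' ∘ g) = tensm f' g' ∘ tensm f g;
  unitI : mon_cat;
  assoc : forall X Y Z : mon_cat,
    Hom (tens (tens X Y) Z) (tens X (tens Y Z));
  assoc_inv : forall X Y Z : mon_cat,
    Hom (tens X (tens Y Z)) (tens (tens X Y) Z);
  assocK : forall X Y Z, assoc_inv X Y Z ∘ assoc X Y Z = idm _;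
  assoc_invK : forall X Y Z, assoc X Y Z ∘ assoc_inv X Y Z = idm _;
  assoc_nat : forall (X X' Y Y' Z Z' : mon_cat)
      (f : Hom X X') (g : Hom Y Y') (h : Hom Z Z'),
    assoc X' Y' Z' ∘ tensm (tensm f g) h
    = tensm f (tensm g h) ∘ assoc X Y Z;
  lam : forall X : mon_cat, Hom (tens unitI X) X;
  lam_inv : forall X : mon_cat, Hom X (tens unitI X);
  lamK : forall X, lam_inv X ∘ lam X = idm _;
  lam_invK : forall X, lam X ∘ lam_inv X = idm _;
  lam_nat : forall (X Y : mon_cat) (f : Hom X Y),
    lam Y ∘ tensm (idm unitI) f = f ∘ lam X;
  rho : forall X : mon_cat, Hom (tens X unitI) X;
  rho_inv : forall X : mon_cat, Hom X (tens X unitI);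
  rhoK : forall X, rho_inv X ∘ rho X = idm _;
  rho_invK : forall X, rho X ∘ rho_inv X = idm _;
  rho_nat : forall (X Y : mon_cat) (f : Hom X Y),
    rho Y ∘ tensm f (idm unitI) = f ∘ rho X;
  triangle : forall X Y : mon_cat,
    tensm (idm X) (lam Y) ∘ assoc X unitI Y = tensm (rho X) (idm Y);
  pentagon : forall W X Y Z : mon_cat,
    assoc W X (tens Y Z) ∘ assoc (tens W X) Y Z
    = tensm (idm W) (assoc X Y Z) ∘ assoc W (tens X Y) Z
      ∘ tensm (assoc W X Y) (idm Z)
}.

Arguments tens {_} _ _.
Arguments tensm {_ _ _ _ _} _ _.
Arguments unitI {_}.
Arguments assoc {_} _ _ _.
Arguments assoc_inv {_} _ _ _.
Arguments lam {_} _.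
Arguments lam_inv {_} _.
Arguments rho {_} _.
Arguments rho_inv {_} _.

Notation "X ⊗ Y" := (tens X Y) : vcat_scope.
Notation "f ⊠ g" := (tensm f g) : vcat_scope.

(* The axiom [lam_braid] follows from the other ones; as in Mac Lane's
   definition it is nevertheless listed. Closedness: every functor [- ⊗ Y] has
   a right adjoint [ihom Y], presented by its counit [ev] and the universal
   property of [ev]. *)
Record SMCCategory := {
  smc_mon :> MonCategory;
  braid : forall X Y : smc_mon, Hom (X ⊗ Y) (Y ⊗ X);
  braid_nat : forall (X X' Y Y' : smc_mon) (f : Hom X X') (g : Hom Y Y'),
    braid X' Y' ∘ (f ⊠ g) = (g ⊠ f) ∘ braid X Y;
  braidK : forall X Y, braid Y X ∘ braid X Y = idm (X ⊗ Y);
  lam_braid : forall X, lam X ∘ braid X unitI = rho X;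
  hexagon : forall X Y Z : smc_mon,
    assoc Y Z X ∘ braid X (Y ⊗ Z) ∘ assoc X Y Z
    = (idm Y ⊠ braid X Z) ∘ assoc Y X Z ∘ (braid X Y ⊠ idm Z);
  ihom : smc_mon -> smc_mon -> smc_mon;
  ev : forall Y Z : smc_mon, Hom (ihom Y Z ⊗ Y) Z;
  curry : forall X Y Z : smc_mon, Hom (X ⊗ Y) Z -> Hom X (ihom Y Z);
  curry_spec : forall (X Y Z : smc_mon) (f : Hom (X ⊗ Y) Z),
    ev Y Z ∘ (curry f ⊠ idm Y) = f;
  curry_uniq : forall (X Y Z : smc_mon) (f : Hom (X ⊗ Y) Z)
      (g : Hom X (ihom Y Z)),
    ev Y Z ∘ (g ⊠ idm Y) = f -> g = curry f
}.

Arguments braid {_} _ _.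

Lemma tens_idl_faithful (V : MonCategory) (X Y : V) (f g : Hom X Y) :
  idm unitI ⊠ f = idm unitI ⊠ g -> f = g.
Proof.
move=> e; rewrite -(comp_idr f) -(comp_idr g) -(lam_invK X) !comp_assoc.
by rewrite -!lam_nat e.
Qed.

Lemma tens_idr_faithful (V : MonCategory) (X Y : V) (f g : Hom X Y) :
  f ⊠ idm unitI = g ⊠ idm unitI -> f = g.
Proof.
move=> e; rewrite -(comp_idr f) -(comp_idr g) -(rho_invK X) !comp_assoc.
by rewrite -!rho_nat e.
Qed.

Lemma comp_canc_r (C : Category) (X Y Z : C) (s : Hom X Y) (r : Hom Y X)
    (f g : Hom Y Z) :
  s ∘ r = idm Y -> f ∘ s = g ∘ s -> f = g.
Proof.
move=> sr e; rewrite -(comp_idr f) -(comp_idr g) -sr !comp_assoc.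
by rewrite e.
Qed.

Lemma comp_canc_l (C : Category) (X Y Z : C) (s : Hom Y Z) (r : Hom Z Y)
    (f g : Hom X Y) :
  r ∘ s = idm Y -> s ∘ f = s ∘ g -> f = g.
Proof.
move=> rs e; rewrite -(comp_idl f) -(comp_idl g) -rs -!comp_assoc.
by rewrite e.
Qed.

Lemma tens_split_l (V : MonCategory) (X X' Y Y' : V) (f : Hom X X')
    (g : Hom Y Y') : f ⊠ g = (f ⊠ idm Y') ∘ (idm X ⊠ g).
Proof. by rewrite -tens_comp comp_idl comp_idr. Qed.

Lemma tens_split_r (V : MonCategory) (X X' Y Y' : V) (f : Hom X X')
    (g : Hom Y Y') : f ⊠ g = (idm X' ⊠ g) ∘ (f ⊠ idm Y).
Proof. by rewrite -tens_comp comp_idl comp_idr. Qed.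

Lemma tens_compr (V : MonCategory) (X Y Y' Y'' : V) (g' : Hom Y' Y'')
    (g : Hom Y Y') : idm X ⊠ (g' ∘ g) = (idm X ⊠ g') ∘ (idm X ⊠ g).
Proof. by rewrite -tens_comp comp_idl. Qed.

Lemma tens_compl (V : MonCategory) (X X' X'' Y : V) (f' : Hom X' X'')
    (f : Hom X X') : (f' ∘ f) ⊠ idm Y = (f' ⊠ idm Y) ∘ (f ⊠ idm Y).
Proof. by rewrite -tens_comp comp_idl. Qed.

Lemma lam_tens (V : MonCategory) (X Y : V) :
  lam (X ⊗ Y) ∘ assoc unitI X Y = lam X ⊠ idm Y.
Proof.
apply: tens_idl_faithful; rewrite tens_compr.
set s := assoc unitI (unitI ⊗ X) Y ∘ (assoc unitI unitI X ⊠ idm Y).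
set r := (assoc_inv unitI unitI X ⊠ idm Y) ∘ assoc_inv unitI (unitI ⊗ X) Y.
apply: (@comp_canc_r _ _ _ _ s r).
  rewrite /s /r -comp_assoc (comp_assoc (assoc _ _ _ ⊠ _)) -tens_compl.
  by rewrite assoc_invK tens_id comp_idl assoc_invK.
rewrite /s -[LHS]comp_assoc (comp_assoc (idm unitI ⊠ assoc _ _ _)) -pentagon.
rewrite !comp_assoc triangle -(tens_id X Y) -assoc_nat -triangle.
by rewrite tens_compl !comp_assoc assoc_nat.
Qed.

Lemma lam_rho_unit (V : MonCategory) : lam unitI = rho (@unitI V).
Proof.
apply: tens_idr_faithful; rewrite -lam_tens -triangle; congr (_ ∘ _).
apply: (comp_canc_l (lamK _)).
by rewrite lam_nat.
Qed.

Lemma lam_inv_rho_inv_unit (V : MonCategory) :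
  lam_inv unitI = rho_inv (@unitI V).
Proof.
apply: (comp_canc_l (lamK _)).
by rewrite lam_invK lam_rho_unit rho_invK.
Qed.

Lemma assoc_lam_inv_unit (V : MonCategory) :
  assoc unitI unitI unitI ∘ (lam_inv (@unitI V) ⊠ idm unitI)
  = idm unitI ⊠ lam_inv unitI.
Proof.
apply: (@comp_canc_l _ _ _ _ (idm unitI ⊠ lam unitI)
          (idm unitI ⊠ lam_inv unitI)).
  by rewrite -tens_compr lamK tens_id.
rewrite comp_assoc triangle -tens_compl -tens_compr lam_invK.
by rewrite -lam_rho_unit lam_invK !tens_id.
Qed.

Lemma rho_braid (V : SMCCategory) (X : V) : rho X ∘ braid unitI X = lam X.
Proof. by rewrite -lam_braid -comp_assoc braidK comp_idr. Qed.

Lemma braid_tens (V : SMCCategory) (X Y Z : V) :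
  braid (X ⊗ Y) Z
  = assoc Z X Y ∘ (braid X Z ⊠ idm Y) ∘ assoc_inv X Z Y
    ∘ (idm X ⊠ braid Y Z) ∘ assoc X Y Z.
Proof.
set L := assoc X Y Z ∘ braid Z (X ⊗ Y).
apply: (@comp_canc_r _ _ _ _ (braid Z (X ⊗ Y) ∘ assoc Z X Y)
          (assoc_inv Z X Y ∘ braid (X ⊗ Y) Z)).
  rewrite -comp_assoc (comp_assoc (assoc _ _ _)) assoc_invK comp_idl.
  by rewrite braidK.
rewrite comp_assoc braidK comp_idl -comp_assoc (comp_assoc (assoc X Y Z)).
rewrite hexagon -(comp_assoc _ (idm X ⊠ _)) !comp_assoc.
rewrite -(comp_assoc _ (idm X ⊠ braid Y Z)) -tens_compr braidK tens_id comp_idr.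
rewrite -(comp_assoc _ (assoc_inv X Z Y)) assocK comp_idr.
by rewrite -comp_assoc -tens_compl braidK tens_id comp_idr.
Qed.

Lemma braid_reverse (V : SMCCategory) (X Y Z : V) :
  (idm Z ⊠ braid X Y) ∘ braid (X ⊗ Y) Z
  = assoc Z Y X ∘ (braid Y Z ⊠ idm X) ∘ braid X (Y ⊗ Z) ∘ assoc X Y Z.
Proof.
have hex : braid X (Y ⊗ Z) ∘ assoc X Y Z
    = assoc_inv Y Z X ∘ (idm Y ⊠ braid X Z) ∘ assoc Y X Z
      ∘ (braid X Y ⊠ idm Z).
  apply: (comp_canc_l (assocK _ _ _)).
  by rewrite !comp_assoc assoc_invK comp_idl hexagon.
by rewrite -braid_nat braid_tens -(comp_assoc _ (braid X _)) hex !comp_assoc.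
Qed.

Record VCategory (V : SMCCategory) := {
  vob :> Type;
  vhom : vob -> vob -> V;
  vid : forall X, Hom unitI (vhom X X);
  vcomp : forall X Y Z, Hom (vhom Y Z ⊗ vhom X Y) (vhom X Z);
  vcomp_assoc : forall W X Y Z,
    vcomp W Y Z ∘ (idm (vhom Y Z) ⊠ vcomp W X Y) ∘ assoc _ _ _
    = vcomp W X Z ∘ (vcomp X Y Z ⊠ idm (vhom W X));
  vcomp_idl : forall X Y,
    vcomp X Y Y ∘ (vid Y ⊠ idm (vhom X Y)) = lam (vhom X Y);
  vcomp_idr : forall X Y,
    vcomp X X Y ∘ (idm (vhom X Y) ⊠ vid X) = rho (vhom X Y)
}.

Arguments vhom {_ _} _ _.
Arguments vid {_ _} _.
Arguments vcomp {_ _} _ _ _.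

Definition ucomp (V : SMCCategory) (B : VCategory V) (X Y Z : B)
    (g : Hom unitI (vhom Y Z)) (f : Hom unitI (vhom X Y)) :
    Hom unitI (vhom X Z) :=
  vcomp X Y Z ∘ (g ⊠ f) ∘ lam_inv unitI.

Lemma ucomp_idl (V : SMCCategory) (B : VCategory V) (X Y : B)
    (f : Hom unitI (vhom X Y)) : ucomp (vid Y) f = f.
Proof.
rewrite /ucomp tens_split_l comp_assoc vcomp_idl lam_nat -comp_assoc.
by rewrite lam_invK comp_idr.
Qed.

Lemma ucomp_idr (V : SMCCategory) (B : VCategory V) (X Y : B)
    (f : Hom unitI (vhom X Y)) : ucomp f (vid X) = f.
Proof.
rewrite /ucomp tens_split_r comp_assoc vcomp_idr rho_nat -comp_assoc.
by rewrite -lam_rho_unit lam_invK comp_idr.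
Qed.

Lemma ucomp_assoc (V : SMCCategory) (B : VCategory V) (W X Y Z : B)
    (h : Hom unitI (vhom Y Z)) (g : Hom unitI (vhom X Y))
    (f : Hom unitI (vhom W X)) :
  ucomp h (ucomp g f) = ucomp (ucomp h g) f.
Proof.
rewrite /ucomp.
have -> : h ⊠ (vcomp W X Y ∘ (g ⊠ f) ∘ lam_inv unitI)
    = (idm _ ⊠ vcomp W X Y) ∘ (h ⊠ (g ⊠ f)) ∘ (idm _ ⊠ lam_inv unitI).
  by rewrite -!tens_comp comp_idl comp_idr.
have -> : (vcomp X Y Z ∘ (h ⊠ g) ∘ lam_inv unitI) ⊠ f
    = (vcomp X Y Z ⊠ idm _) ∘ ((h ⊠ g) ⊠ f) ∘ (lam_inv unitI ⊠ idm _).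
  by rewrite -!tens_comp comp_idl comp_idr.
rewrite !comp_assoc -vcomp_assoc -(comp_assoc _ (assoc _ _ _)) assoc_nat.
by rewrite comp_assoc -(comp_assoc _ (assoc _ _ _)) assoc_lam_inv_unit.
Qed.

Definition underlying (V : SMCCategory) (B : VCategory V) : Category := {|
  Ob := B;
  Hom := fun X Y => Hom unitI (vhom X Y);
  idm := fun X => vid X;
  comp := fun X Y Z g f => ucomp g f;
  comp_idl := fun X Y f => ucomp_idl f;
  comp_idr := fun X Y f => ucomp_idr f;
  comp_assoc := fun W X Y Z h g f => ucomp_assoc h g f
|}.

Definition Mor (V : SMCCategory) (B : VCategory V) (X Y : B) : Type :=
  @Hom (underlying B) X Y.

Definition vop (V : SMCCategory) (B : VCategory V) : VCategory V.
Proof.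
refine {|
  vob := B;
  vhom := fun X Y => @vhom V B Y X;
  vid := fun X => vid X;
  vcomp := fun X Y Z =>
    vcomp Z Y X ∘ braid (@vhom V B Z Y) (@vhom V B Y X)
|}.
- move=> W X Y Z.
  rewrite -(comp_assoc _ (braid _ _) (idm _ ⊠ _)) braid_nat.
  rewrite -(comp_assoc _ (braid _ _) (_ ⊠ idm _)) braid_nat.
  rewrite tens_compr tens_compl -(comp_assoc (idm _ ⊠ _)) braid_reverse.
  by rewrite !comp_assoc vcomp_assoc.
- by move=> X Y; rewrite -comp_assoc braid_nat comp_assoc vcomp_idr rho_braid.
- by move=> X Y; rewrite -comp_assoc braid_nat comp_assoc vcomp_idl lam_braid.
Defined.

(* Postcomposition and precomposition:
   [post A m] is B(A,m) and [pre e B] is B(e,B). *)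
Definition post (V : SMCCategory) (B : VCategory V) (A B1 B2 : B)
    (m : Mor B1 B2) : Hom (vhom A B1) (vhom A B2) :=
  vcomp A B1 B2 ∘ (m ⊠ idm (vhom A B1)) ∘ lam_inv (vhom A B1).

Definition pre (V : SMCCategory) (B : VCategory V) (A1 A2 : B)
    (e : Mor A1 A2) (C : B) : Hom (vhom A2 C) (vhom A1 C) :=
  vcomp A1 A2 C ∘ (idm (vhom A2 C) ⊠ e) ∘ rho_inv (vhom A2 C).

Arguments post {_ _} _ {_ _} _.
Arguments pre {_ _ _ _} _ _.

Lemma post_vop (V : SMCCategory) (B : VCategory V) (A1 A2 : B)
    (e : Mor A1 A2) (C : B) :
  @post V (vop B) C A2 A1 e = pre e C.
Proof.
rewrite /post /pre /= -(comp_assoc (vcomp A1 A2 C)) braid_nat comp_assoc.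
rewrite -comp_assoc; congr (_ ∘ _).
apply: (comp_canc_l (rhoK _)).
by rewrite comp_assoc rho_braid lam_invK rho_invK.
Qed.

(* Separating the structure from the object map allows an adjoint with a
   prescribed object map to be stated in [exhibit_V_reflective]. *)
Record VFunctorOn (V : SMCCategory) (A B : VCategory V) (F : A -> B) := {
  vf_hom : forall X Y : A, Hom (vhom X Y) (vhom (F X) (F Y));
  vf_id : forall X, vf_hom X X ∘ vid X = vid (F X);
  vf_comp : forall X Y Z,
    vf_hom X Z ∘ vcomp X Y Z
    = vcomp (F X) (F Y) (F Z) ∘ (vf_hom Y Z ⊠ vf_hom X Y)
}.

Record VFunctor (V : SMCCategory) (A B : VCategory V) := {
  vf_ob :> A -> B;
  vf_str : VFunctorOn vf_ob
}.

Definition fhom (V : SMCCategory) (A B : VCategory V) (F : VFunctor A B)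
    (X Y : A) : Hom (vhom X Y) (vhom (F X) (F Y)) := vf_hom (vf_str F) X Y.

Definition fmor (V : SMCCategory) (A B : VCategory V) (F : VFunctor A B)
    (X Y : A) (f : Mor X Y) : Mor (F X) (F Y) := fhom F X Y ∘ f.

Definition vfun_id (V : SMCCategory) (A : VCategory V) : VFunctor A A.
Proof.
refine {|
  vf_ob := fun X => X;
  vf_str := {| vf_hom := fun X Y => idm (@vhom V A X Y) |}
|}.
- by move=> X; rewrite comp_idl.
- by move=> X Y Z; rewrite tens_id comp_idl comp_idr.
Defined.

Definition vfun_comp (V : SMCCategory) (A B C : VCategory V)
    (G : VFunctor B C) (F : VFunctor A B) : VFunctor A C.
Proof.
refine {|
  vf_ob := fun X => G (F X);
  vf_str := {| vf_hom := fun X Y => fhom G (F X) (F Y) ∘ fhom F X Y |}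
|}.
- by move=> X; rewrite -comp_assoc /fhom !vf_id.
- move=> X Y Z; rewrite -comp_assoc /fhom vf_comp comp_assoc vf_comp.
  by rewrite -comp_assoc -tens_comp.
Defined.

Record VNat (V : SMCCategory) (A B : VCategory V) (F G : VFunctor A B) := {
  vn_comp :> forall X : A, Mor (F X) (G X);
  vn_nat : forall X Y : A,
    post (F X) (vn_comp Y) ∘ fhom F X Y
    = pre (vn_comp X) (G Y) ∘ fhom G X Y
}.

(* The equations of the two records below are equations between morphisms of
   the underlying ordinary category. *)
Record VMonad (V : SMCCategory) (B : VCategory V) := {
  mT :> VFunctor B B;
  meta : VNat (vfun_id B) mT;
  mmu : VNat (vfun_comp mT mT) mT;
  mmu_assoc : forall X : B, ucomp (mmu X) (fmor mT (mmu X))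
                            = ucomp (mmu X) (mmu (mT X));
  mmu_etaT : forall X : B, ucomp (mmu X) (meta (mT X)) = vid (mT X);
  mmu_Teta : forall X : B, ucomp (mmu X) (fmor mT (meta X)) = vid (mT X)
}.

Record VAdjunction (V : SMCCategory) (A B : VCategory V)
    (L : VFunctor A B) (R : VFunctor B A) := {
  adj_unit : VNat (vfun_id A) (vfun_comp R L);
  adj_counit : VNat (vfun_comp L R) (vfun_id B);
  adj_triangle_l : forall X : A,
    ucomp (adj_counit (L X)) (fmor L (adj_unit X)) = vid (L X);
  adj_triangle_r : forall Y : B,
    ucomp (fmor R (adj_counit Y)) (adj_unit (R Y)) = vid (R Y)
}.

Definition vfull (V : SMCCategory) (B : VCategory V) (P : B -> Prop) :
    VCategory V := {|
  vob := {X : B | P X};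
  vhom := fun X Y => @vhom V B (proj1_sig X) (proj1_sig Y);
  vid := fun X => vid (proj1_sig X);
  vcomp := fun X Y Z => vcomp (proj1_sig X) (proj1_sig Y) (proj1_sig Z);
  vcomp_assoc := fun W X Y Z => vcomp_assoc _ _ _ _;
  vcomp_idl := fun X Y => vcomp_idl _ _;
  vcomp_idr := fun X Y => vcomp_idr _ _
|}.

Definition vincl (V : SMCCategory) (B : VCategory V) (P : B -> Prop) :
    VFunctor (vfull P) B.
Proof.
refine {|
  vf_ob := fun X : vfull P => proj1_sig X;
  vf_str := {| vf_hom := fun X Y : vfull P =>
    idm (@vhom V B (proj1_sig X) (proj1_sig Y)) |}
|}.
- by move=> X; rewrite comp_idl.
- by move=> X Y Z; rewrite tens_id comp_idl comp_idr.
Defined.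

Definition replete (V : SMCCategory) (B : VCategory V) (P : B -> Prop) : Prop :=
  forall (X Y : B) (f : Mor X Y), IsIso (C := underlying B) f -> P X -> P Y.

(* A V-reflective-subcategory is replete by definition, hence the first
   conjunct. The left V-adjoint has object map [X |-> K X] on the nose, so that
   its unit can be compared with [r] without transport. *)
Definition exhibit_V_reflective (V : SMCCategory) (B : VCategory V)
    (P : B -> Prop) (K : B -> B) (r : forall X : B, Mor X (K X)) : Prop :=
  replete P /\
  exists (PK : forall X, P (K X))
    (S : VFunctorOn (A := B) (B := vfull P) (fun X => exist P (K X) (PK X)))
    (adj : VAdjunction {| vf_ob := fun X => exist P (K X) (PK X) : vfull P;
                          vf_str := S |} (vincl P)),
    forall X : B, adj_unit adj X = r X.

Definition IsVMono (V : SMCCategory) (B : VCategory V) (B1 B2 : B)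
    (m : Mor B1 B2) : Prop :=
  forall A : B, IsMono (post A m).

Definition IsVEpi (V : SMCCategory) (B : VCategory V) (A1 A2 : B)
    (e : Mor A1 A2) : Prop :=
  @IsVMono V (vop B) A2 A1 e.

Definition vorth (V : SMCCategory) (B : VCategory V) (A1 A2 B1 B2 : B)
    (e : Mor A1 A2) (m : Mor B1 B2) : Prop :=
  IsPullback (pre e B1) (post A2 m) (post A1 m) (pre e B2).

Definition MorClass (V : SMCCategory) (B : VCategory V) : Type :=
  forall X Y : B, Mor X Y -> Prop.

Definition mc_sub (V : SMCCategory) (B : VCategory V) (C D : MorClass B) :
    Prop :=
  forall (X Y : B) (f : Mor X Y), C X Y f -> D X Y f.

Definition mc_eq (V : SMCCategory) (B : VCategory V) (C D : MorClass B) :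
    Prop :=
  forall (X Y : B) (f : Mor X Y), C X Y f <-> D X Y f.

Definition mc_cap (V : SMCCategory) (B : VCategory V) (C D : MorClass B) :
    MorClass B :=
  fun X Y f => C X Y f /\ D X Y f.

Definition orth_down (V : SMCCategory) (B : VCategory V) (E : MorClass B) :
    MorClass B :=
  fun B1 B2 m => forall (A1 A2 : B) (e : Mor A1 A2), E A1 A2 e -> vorth e m.

Definition orth_up (V : SMCCategory) (B : VCategory V) (M : MorClass B) :
    MorClass B :=
  fun A1 A2 e => forall (B1 B2 : B) (m : Mor B1 B2), M B1 B2 m -> vorth e m.

Definition VPrefactorizationSystem (V : SMCCategory) (B : VCategory V)
    (E M : MorClass B) : Prop :=
  mc_eq (orth_down E) M /\ mc_eq (orth_up M) E.

Definition VProper (V : SMCCategory) (B : VCategory V) (E M : MorClass B) :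
    Prop :=
  mc_sub E (@IsVEpi V B) /\ mc_sub M (@IsVMono V B).

Definition SigmaT (V : SMCCategory) (B : VCategory V) (T : VMonad B) :
    MorClass B :=
  fun X Y f => IsIso (C := underlying B) (fmor T f).

Definition SigmaComplete (V : SMCCategory) (B : VCategory V)
    (Sigma : MorClass B) (X : B) : Prop :=
  forall (A1 A2 : B) (h : Mor A1 A2), Sigma A1 A2 h -> IsIso (pre h X).

Definition TSeparated (V : SMCCategory) (B : VCategory V) (T : VMonad B)
    (M : MorClass B) (X : B) : Prop :=
  M X (T X) (meta T X).

Definition SigmaClosedEmb (V : SMCCategory) (B : VCategory V)
    (M Sigma : MorClass B) : MorClass B :=
  mc_cap (orth_down Sigma) M.

Definition SigmaDense (V : SMCCategory) (B : VCategory V)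
    (M Sigma : MorClass B) : MorClass B :=
  orth_up (SigmaClosedEmb M Sigma).

Definition CompleteSeparated (V : SMCCategory) (B : VCategory V)
    (T : VMonad B) (M Sigma : MorClass B) (X : B) : Prop :=
  SigmaComplete Sigma X /\ TSeparated T M X.

(* Main.v *)
From Corelib Require Import ssreflect.
From Stdlib Require Import ClassicalEpsilon.
Require Import Defs.

Set Implicit Arguments.
Unset Strict Implicit.
Unset Printing Implicit Defensive.

(** Write P for the class of Sigma-complete T-separated objects.  It suffices
    to show that K X lies in P and that restriction along [r X],
    B(K X, C) -> B(X, C), is an isomorphism in V for every C in P: the
    reflector and the adjunction are then forced
    ([reflective_of_universal_arrows]).

    The basic remark ([pre_iso_of_SigmaT]) is that a morphism h inverted by T
    is also inverted by B(-, T C), since B(-, T C) is a retract of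
    B(T -, T C): extend a map A -> T C to T A -> T C by the multiplication,
    restrict it back along the unit.  It has three consequences.

    - For C in P the unit [meta T C] is a Sigma-closed M-embedding, because C
      and T C are both Sigma-complete and a square with two parallel
      invertible sides is a pullback ([completeSeparated_eta_closed]).

    - Any Y carrying a Sigma-closed M-embedding into some T X lies in P
      ([closed_in_T_completeSeparated]).  Completeness is stability of
      isomorphisms under pullback; separatedness holds because the embedding
      factors through [meta T Y], and M admits left cancellation
      as every morphism of E is a V-epi.  In particular K X lies in P.

    - If T inverts [r X], then for C in P the pullback square
      expressing that [r X] is orthogonal to [meta T C] has the invertible
      side B(K X, T C) -> B(X, T C); the opposite side B(K X, C) -> B(X, C) is
      therefore invertible.

    What remains is that T inverts [r X] ([dense_factor_inverted]).  The
    extension of [i X] to T (K X) -> T X is a retraction of T (r X).  That it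
    is also a section amounts, by freeness of T (K X), to
    T (r X) . i X = meta T (K X).  Both sides have the same restriction along
    the dense morphism [r X], and [meta T (K X)] is a Sigma-closed embedding,
    so orthogonality gives a fill-in u : K X -> K X relating them; since
    [i X] is monic and i X . u = i X, this u is the identity. *)

(** * Calculus of the hom-functors of a V-category *)

Section HomCalculus.
Variables (V : SMCCategory) (B : VCategory V).

Lemma lam_inv_nat (X Y : V) (f : Hom X Y) :
  lam_inv Y ∘ f = (idm unitI ⊠ f) ∘ lam_inv X.
Proof.
apply: (comp_canc_l (lamK _)).
by rewrite !comp_assoc lam_invK comp_idl lam_nat -comp_assoc lam_invK comp_idr.
Qed.

Lemma rho_inv_nat (X Y : V) (f : Hom X Y) :
  rho_inv Y ∘ f = (f ⊠ idm unitI) ∘ rho_inv X.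
Proof.
apply: (comp_canc_l (rhoK _)).
by rewrite !comp_assoc rho_invK comp_idl rho_nat -comp_assoc rho_invK comp_idr.
Qed.

Lemma post_mor (A X Y : B) (m : Mor X Y) (f : Mor A X) :
  post A m ∘ f = ucomp m f.
Proof.
rewrite /post /ucomp -[LHS]comp_assoc lam_inv_nat comp_assoc.
by rewrite -(comp_assoc _ (m ⊠ _)) -tens_split_l.
Qed.

Lemma pre_mor (A X Y : B) (e : Mor A X) (f : Mor X Y) :
  pre e Y ∘ f = ucomp f e.
Proof.
rewrite /pre /ucomp -[LHS]comp_assoc rho_inv_nat comp_assoc lam_inv_rho_inv_unit.
by rewrite -(comp_assoc _ (_ ⊠ e)) -tens_split_r.
Qed.

(** B(W, m) is a map of right modules: associativity of composition with its
    first argument fixed at [m]. *)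
Lemma post_vcomp (W X Y Z : B) (m : Mor Y Z) :
  post W m ∘ vcomp W X Y = vcomp W X Z ∘ (post X m ⊠ idm (vhom W X)).
Proof.
apply: (@comp_canc_r _ _ _ _ (lam _) (lam_inv _)); first exact: lam_invK.
rewrite /post -!comp_assoc -lam_nat (comp_assoc (lam_inv _)) lamK comp_idl.
rewrite -tens_split_l tens_split_r.
apply: (@comp_canc_r _ _ _ _ (assoc _ _ _) (assoc_inv _ _ _)).
  exact: assoc_invK.
rewrite -!comp_assoc lam_tens -tens_compl -!comp_assoc lamK comp_idr.
rewrite -(tens_id (vhom X Y)) -assoc_nat tens_compl !comp_assoc.
by rewrite vcomp_assoc.
Qed.

End HomCalculus.

Section HomFunctors.
Variables (V : SMCCategory) (B : VCategory V).

(** Dual to [post_vcomp], read in [vop B]. *)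
Lemma pre_vcomp (W W' X Y : B) (e : Mor W' W) :
  pre e Y ∘ vcomp W X Y = vcomp W' X Y ∘ (idm (vhom X Y) ⊠ pre e X).
Proof.
have H := @post_vcomp V (vop B) Y X W W' e.
rewrite !post_vop /= in H.
apply: (@comp_canc_r _ _ _ _ (braid _ _) (braid _ _)); first exact: braidK.
by rewrite -!comp_assoc -braid_nat !comp_assoc in H *.
Qed.

(** Composition is extranatural in the middle object, which is associativity
    with the middle argument fixed at [m]. *)
Lemma vcomp_post_pre (W X X' Y : B) (m : Mor X X') :
  vcomp W X' Y ∘ (idm (vhom X' Y) ⊠ post W m)
  = vcomp W X Y ∘ (pre m Y ⊠ idm (vhom W X)).
Proof.
apply: (@comp_canc_r _ _ _ _ (idm _ ⊠ lam _) (idm _ ⊠ lam_inv _)).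
  by rewrite -tens_compr lam_invK tens_id.
apply: (@comp_canc_r _ _ _ _ (assoc _ _ _) (assoc_inv _ _ _)).
  exact: assoc_invK.
rewrite -[in LHS](comp_assoc _ (idm _ ⊠ post _ _)) -tens_compr.
rewrite /post -!comp_assoc lamK comp_idr triangle -tens_compl.
rewrite /pre -!comp_assoc rhoK comp_idr tens_compr tens_compl.
by rewrite !comp_assoc -vcomp_assoc -!comp_assoc assoc_nat.
Qed.

Lemma pre_post (A A' X Y : B) (e : Mor A' A) (m : Mor X Y) :
  pre e Y ∘ post A m = post A' m ∘ pre e X.
Proof.
rewrite {1}/post !comp_assoc pre_vcomp -(comp_assoc _ (_ ⊠ _) (_ ⊠ _)).
rewrite -tens_split_r tens_split_l /post -!comp_assoc.
by rewrite -lam_inv_nat /pre -!comp_assoc.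
Qed.

Lemma post_comp (A X Y Z : B) (n : Mor Y Z) (m : Mor X Y) :
  post A (ucomp n m) = post A n ∘ post A m.
Proof.
rewrite [in RHS](_ : post A m = vcomp A X Y ∘ (m ⊠ idm _) ∘ lam_inv _) //.
rewrite !comp_assoc post_vcomp -(comp_assoc _ (_ ⊠ _) (_ ⊠ _)).
by rewrite -tens_compl post_mor.
Qed.

Lemma pre_comp (A A' A'' Y : B) (e : Mor A' A) (d : Mor A'' A') :
  pre (ucomp e d) Y = pre d Y ∘ pre e Y.
Proof.
rewrite [in RHS](_ : pre e Y = vcomp A' A Y ∘ (idm _ ⊠ e) ∘ rho_inv _) //.
rewrite !comp_assoc pre_vcomp -(comp_assoc _ (_ ⊠ _) (_ ⊠ _)).
by rewrite -tens_compr pre_mor.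
Qed.

Lemma post_id (A X : B) : post A (vid X) = idm (vhom A X).
Proof. by rewrite /post vcomp_idl lam_invK. Qed.

Lemma pre_id (A X : B) : pre (vid A) X = idm (vhom A X).
Proof. by rewrite /pre vcomp_idr rho_invK. Qed.

(** The next three rules act on right-nested composites; plain reassociation
    would unfold [post] and [pre], which are themselves composites. *)
Lemma post_post_comp (W : V) (A X Y Z : B) (n : Mor Y Z) (m : Mor X Y)
    (f : Hom W (vhom A X)) :
  post A n ∘ (post A m ∘ f) = post A (ucomp n m) ∘ f.
Proof. by rewrite (comp_assoc (post A n) (post A m)) -post_comp. Qed.

Lemma pre_pre_comp (W : V) (A A' A'' Y : B) (e : Mor A' A) (d : Mor A'' A')
    (f : Hom W (vhom A Y)) :
  pre d Y ∘ (pre e Y ∘ f) = pre (ucomp e d) Y ∘ f.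
Proof. by rewrite (comp_assoc (pre d Y) (pre e Y)) -pre_comp. Qed.

Lemma pre_post_comp (W : V) (A A' X Y : B) (e : Mor A' A) (m : Mor X Y)
    (f : Hom W (vhom A X)) :
  pre e Y ∘ (post A m ∘ f) = post A' m ∘ (pre e X ∘ f).
Proof.
by rewrite (comp_assoc (pre e Y) (post A m)) pre_post
  -(comp_assoc (post A' m) (pre e X)).
Qed.

Lemma post_vfull (P : B -> Prop) (A X Y : vfull P)
    (m : Mor (proj1_sig X) (proj1_sig Y)) :
  @post V (vfull P) A X Y m = post (proj1_sig A) m.
Proof. by []. Qed.

Lemma pre_vfull (P : B -> Prop) (A A' Y : vfull P)
    (e : Mor (proj1_sig A') (proj1_sig A)) :
  @pre V (vfull P) A' A e Y = pre e (proj1_sig Y).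
Proof. by []. Qed.

End HomFunctors.

(** * V-functors and natural transformations on underlying morphisms *)

Section VFunctors.
Variables (V : SMCCategory) (B : VCategory V) (F : VFunctor B B).

Lemma fmor_comp (X Y Z : B) (g : Mor Y Z) (f : Mor X Y) :
  fmor F (ucomp g f) = ucomp (fmor F g) (fmor F f).
Proof.
rewrite /fmor /ucomp /fhom !comp_assoc vf_comp -(comp_assoc _ (_ ⊠ _) (_ ⊠ _)).
by rewrite -tens_comp.
Qed.

Lemma fhom_pre (X X' Y : B) (h : Mor X' X) :
  fhom F X' Y ∘ pre h Y = pre (fmor F h) (F Y) ∘ fhom F X Y.
Proof.
rewrite /pre -(comp_assoc _ (rho_inv _)) rho_inv_nat !comp_assoc /fhom vf_comp.
rewrite -(comp_assoc _ (_ ⊠ _) (_ ⊠ _)) -(comp_assoc _ (_ ⊠ _) (_ ⊠ _)).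
by rewrite -!tens_comp comp_idl !comp_idr.
Qed.

Lemma vnat_mor (G : VFunctor B B) (a : VNat F G) (X Y : B) (f : Mor X Y) :
  ucomp (a Y) (fmor F f) = ucomp (fmor G f) (a X).
Proof.
by rewrite -post_mor -pre_mor /fmor !comp_assoc vn_nat.
Qed.

End VFunctors.

Lemma eta_nat (V : SMCCategory) (B : VCategory V) (T : VMonad B) (X Y : B)
    (f : Mor X Y) :
  ucomp (fmor T f) (meta T X) = ucomp (meta T Y) f.
Proof. by rewrite -vnat_mor /fmor /fhom /= comp_idl. Qed.

(** * Pullbacks and isomorphisms *)

Section Pullbacks.
Variables (C : Category) (P X Y Z : C).
Variables (p : Hom P X) (q : Hom P Y) (f : Hom X Z) (g : Hom Y Z).

Lemma pullback_of_isos : f ∘ p = g ∘ q -> IsIso p -> IsIso g ->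
  IsPullback p q f g.
Proof.
move=> sq [p' [p'p pp']] [g' [g'g gg']]; split=> // W a b e.
exists (p' ∘ a); split; last first.
  by move=> u [<- _]; rewrite comp_assoc p'p comp_idl.
split; first by rewrite comp_assoc pp' comp_idl.
apply: (comp_canc_l g'g).
by rewrite comp_assoc -sq -e -comp_assoc (comp_assoc p) pp' comp_idl.
Qed.

Lemma pullback_iso : IsPullback p q f g -> IsIso g -> IsIso p.
Proof.
move=> [sq pb] [g' [g'g gg']].
have [|s [[ps qs] _]] := pb X (idm X) (g' ∘ f).
  by rewrite comp_assoc gg' comp_idl comp_idr.
have [|u [_ uq]] := pb P p q; first exact: sq.
exists s; split=> //.
have <- : u = s ∘ p.
  apply: uq; rewrite !comp_assoc ps qs comp_idl -comp_assoc sq comp_assoc g'g.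
  by rewrite comp_idl.
by apply: uq; rewrite !comp_idr.
Qed.

End Pullbacks.

(** * Complete separated objects and their reflection *)

Section Reflection.
Variables (V : SMCCategory) (B : VCategory V).

(** Left cancellation for a class right orthogonal to V-epis.  A problem for
    [n] is sent by [b] and [a] to a problem for [m], whose solution comes back
    along the retraction [c]; one triangle commutes because [c] retracts [b],
    the other and uniqueness because restriction along a V-epi is monic.
    Keeping [b] general makes the lemma cover both cancellation of an outer
    factor ([b] an identity) and transport along an isomorphism. *)
Lemma prefact_cancel (E M : MorClass B) (X Y Z Z' : B)
    (n : Mor Y Z) (m : Mor X Z') (a : Mor Z Z') (b : Mor Y X) (c : Mor X Y) :
  VPrefactorizationSystem E M -> VProper E M -> M X Z' m ->
  ucomp a n = ucomp m b -> ucomp c b = vid Y -> M Y Z n.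
Proof.
move=> [downE _] [epiE _] /downE mM an cb; apply/downE => A1 A2 e eE.
have epi W (D : B) (u v : Hom W (vhom A2 D)) : pre e D ∘ u = pre e D ∘ v -> u = v.
  have := epiE _ _ _ eE D; rewrite post_vop; exact.
split=> [|W s t st]; first by rewrite pre_post.
have [_ pb] := mM _ _ _ eE.
have [|u [[ue mu] _]] := pb W (post A1 b ∘ s) (post A2 a ∘ t).
  by rewrite pre_post_comp -st !post_post_comp an.
have ce : pre e Y ∘ (post A2 c ∘ u) = s.
  by rewrite pre_post_comp ue post_post_comp cb post_id comp_idl.
exists (post A2 c ∘ u); split.
  by split=> //; apply: epi; rewrite pre_post_comp ce.
by move=> v [ve _]; apply: epi; rewrite ce.
Qed.

(** [ext] extends a map into T C along the unit of its domain, naturally, and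
    restriction along the unit undoes it.  So B(h, T C) is a retract of
    B(T h, T C), and a retract of an isomorphism is one. *)
Lemma pre_iso_of_SigmaT (T : VMonad B) (A1 A2 C : B) (h : Mor A1 A2) :
  SigmaT T h -> IsIso (pre h (T C)).
Proof.
move=> [g [gh hg]]; rewrite /= in gh hg.
pose ext A := post (T A) (mmu T C) ∘ fhom T A (T C).
have extK A : pre (meta T A) (T C) ∘ ext A = idm _.
  rewrite /ext pre_post_comp -(vn_nat (meta T) A (T C)).
  by rewrite post_post_comp mmu_etaT post_id comp_idl.
have ext_nat : ext A1 ∘ pre h (T C) = pre (fmor T h) (T C) ∘ ext A2.
  by rewrite /ext -[LHS]comp_assoc fhom_pre pre_post_comp.
exists (pre (meta T A2) (T C) ∘ (pre g (T C) ∘ ext A1)); split.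
  rewrite -[LHS]comp_assoc -(comp_assoc (pre g _)) ext_nat pre_pre_comp.
  by rewrite hg pre_id comp_idl extK.
by rewrite !pre_pre_comp -ucomp_assoc -eta_nat ucomp_assoc gh ucomp_idl extK.
Qed.

(** Universal arrows that are isomorphisms of hom-objects in V determine an
    enriched left adjoint: every required equation between maps out of some
    [K X] into an object of P may be checked after restriction along [r X].
    The inverses are only known to exist for each pair of objects, so
    assembling them into the functor and the counit uses a choice
    principle. *)
Lemma reflective_of_universal_arrows (P : B -> Prop) (K : B -> B)
    (r : forall X : B, Mor X (K X)) :
  replete P -> (forall X, P (K X)) ->
  (forall X C, P C -> IsIso (pre (r X) C)) ->
  exhibit_V_reflective P r.
Proof.
move=> repP PK r_iso.
pose inv X C (PC : P C) := proj1_sig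
  (constructive_indefinite_description _ (r_iso X C PC)).
have invK X C PC : pre (r X) C ∘ inv X C PC = idm _.
  by rewrite /inv; case: constructive_indefinite_description => ? [].
have r_inj X C W (u v : Hom W (vhom (K X) C)) :
    P C -> pre (r X) C ∘ u = pre (r X) C ∘ v -> u = v.
  by move=> /(r_iso X) [g [gr _]]; apply: comp_canc_l gr.
pose S_hom X Y : Hom (vhom X Y) (vhom (K X) (K Y)) :=
  inv X (K Y) (PK Y) ∘ post X (r Y).
have S_homE X Y : pre (r X) (K Y) ∘ S_hom X Y = post X (r Y).
  by rewrite /S_hom comp_assoc invK comp_idl.
have S_id X : S_hom X X ∘ vid X = vid (K X).
  apply: (r_inj X (K X)) => //.
  by rewrite comp_assoc S_homE (post_mor (r X) (vid X)) (pre_mor (r X) (vid (K X)))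
             ucomp_idl ucomp_idr.
have S_comp X Y Z : S_hom X Z ∘ vcomp X Y Z
    = vcomp (K X) (K Y) (K Z) ∘ (S_hom Y Z ⊠ S_hom X Y).
  apply: (r_inj X (K Z)) => //.
  rewrite (comp_assoc _ (S_hom X Z)) S_homE (comp_assoc _ (vcomp _ _ _)).
  rewrite pre_vcomp -(comp_assoc _ (idm _ ⊠ _)) -tens_comp.
  rewrite S_homE comp_idl tens_split_r (comp_assoc (vcomp _ _ _)).
  rewrite vcomp_post_pre -(comp_assoc (vcomp _ _ _)) -tens_compl S_homE.
  exact: post_vcomp.
pose S : VFunctorOn (A := B) (B := vfull P) (fun X => exist P (K X) (PK X)) :=
  @Build_VFunctorOn V B (vfull P) (fun X => exist P (K X) (PK X))
    S_hom S_id S_comp.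
pose L : VFunctor B (vfull P) := Build_VFunctor S.
pose eps (C : vfull P) : Mor (K (proj1_sig C)) (proj1_sig C) :=
  inv (proj1_sig C) (proj1_sig C) (proj2_sig C) ∘ vid (proj1_sig C).
have epsK C : ucomp (eps C) (r (proj1_sig C)) = vid (proj1_sig C).
  by rewrite -pre_mor /eps comp_assoc invK comp_idl.
have unit_nat X Y : post X (r Y) ∘ fhom (vfun_id B) X Y
    = pre (r X) (K Y) ∘ fhom (vfun_comp (vincl P) L) X Y.
  by rewrite /fhom /= comp_idl comp_idr S_homE.
have counit_nat (X Y : vfull P) :
    @post V (vfull P) (L (vincl P X)) (L (vincl P Y)) Y (eps Y)
      ∘ fhom (vfun_comp L (vincl P)) X Y
    = @pre V (vfull P) (L (vincl P X)) X (eps X) Y ∘ fhom (vfun_id (vfull P)) X Y.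
  apply: (r_inj (proj1_sig X) (proj1_sig Y)); first exact: proj2_sig Y.
  rewrite /fhom /= !comp_idr.
  rewrite post_vfull pre_vfull comp_assoc pre_post -comp_assoc S_homE.
  by rewrite -post_comp epsK post_id -pre_comp epsK pre_id.
pose un : VNat (vfun_id B) (vfun_comp (vincl P) L) :=
  @Build_VNat V _ _ (vfun_id B) (vfun_comp (vincl P) L) r unit_nat.
pose co : VNat (vfun_comp L (vincl P)) (vfun_id (vfull P)) :=
  @Build_VNat V _ _ (vfun_comp L (vincl P)) (vfun_id (vfull P)) eps counit_nat.
have tri_l X : ucomp (co (L X)) (fmor L (un X)) = vid (L X).
  apply: (r_inj X (K X)) => //.
  transitivity (ucomp (ucomp (eps (L X)) (S_hom X (K X) ∘ r X)) (r X)).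
    exact: pre_mor.
  rewrite -ucomp_assoc -(pre_mor (r X) (S_hom _ _ ∘ _)) comp_assoc S_homE post_mor.
  rewrite ucomp_assoc (epsK (L X)) ucomp_idl.
  by rewrite (pre_mor (r X) (vid (K X))) ucomp_idl.
have tri_r (Y : vfull P) : ucomp (fmor (vincl P) (co Y)) (un (vincl P Y))
    = vid (vincl P Y).
  by rewrite /fmor /fhom /= comp_idl; apply: epsK.
split=> //; exists PK, S.
by exists (@Build_VAdjunction V _ _ L (vincl P) un co tri_l tri_r).
Qed.

Lemma completeSeparated_replete (T : VMonad B) (E M Sigma : MorClass B) :
  VPrefactorizationSystem E M -> VProper E M ->
  replete (CompleteSeparated T M Sigma).
Proof.
move=> EM EMp X Y f [g [gf fg]] [comX sepX]; rewrite /= in gf fg; split.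
  move=> A1 A2 h /comX [k [kh hk]].
  exists (post A2 f ∘ (k ∘ post A1 g)); split.
    rewrite -[LHS]comp_assoc -(comp_assoc k) -pre_post (comp_assoc k) kh comp_idl.
    by rewrite -post_comp fg post_id.
  rewrite pre_post_comp (comp_assoc (pre h X)) hk comp_idl.
  by rewrite -post_comp fg post_id.
apply: (prefact_cancel (a := fmor T g) (b := g) (c := f) EM EMp sepX).
  exact: eta_nat.
exact: fg.
Qed.

(** Both C and T C are Sigma-complete, so two parallel sides of the
    orthogonality square are invertible. *)
Lemma completeSeparated_eta_closed (T : VMonad B) (M Sigma : MorClass B)
    (C : B) :
  mc_sub Sigma (SigmaT T) -> CompleteSeparated T M Sigma C ->
  SigmaClosedEmb M Sigma (meta T C).
Proof.
move=> SigT [comC sepC]; split=> // A1 A2 h hS.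
apply: pullback_of_isos; first by rewrite pre_post.
  exact: comC.
by apply: pre_iso_of_SigmaT; apply: SigT.
Qed.

(** Completeness passes from T X to Y because isomorphisms are stable under
    pullback.  For separatedness, [i] equals its extension T Y -> T X composed
    with [meta T Y], so the unit is the inner factor of a member of M. *)
Lemma closed_in_T_completeSeparated (T : VMonad B) (E M Sigma : MorClass B)
    (X Y : B) (i : Mor Y (T X)) :
  VPrefactorizationSystem E M -> VProper E M -> mc_sub Sigma (SigmaT T) ->
  SigmaClosedEmb M Sigma i -> CompleteSeparated T M Sigma Y.
Proof.
move=> EM EMp SigT [iS iM]; split.
  move=> A1 A2 h hS; apply: (pullback_iso (iS _ _ _ hS)).
  by apply: pre_iso_of_SigmaT; apply: SigT.
apply: (prefact_cancel (a := ucomp (mmu T X) (fmor T i)) (b := vid Y)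
          (c := vid Y) EM EMp iM); last exact: ucomp_idl.
by rewrite -ucomp_assoc eta_nat ucomp_assoc mmu_etaT ucomp_idl ucomp_idr.
Qed.

(** The extension [bar] of [i] to T Y is the inverse of T r.  That T r . bar is
    the identity reduces, T Y being free, to [Tri]. *)
Lemma dense_factor_inverted (T : VMonad B) (E M Sigma : MorClass B)
    (X Y : B) (r : Mor X Y) (i : Mor Y (T X)) :
  VPrefactorizationSystem E M -> VProper E M -> mc_sub Sigma (SigmaT T) ->
  SigmaDense M Sigma r -> SigmaClosedEmb M Sigma i ->
  ucomp i r = meta T X -> SigmaT T r.
Proof.
move=> EM EMp SigT rd ic ir.
have PY := closed_in_T_completeSeparated EM EMp SigT ic.
pose bar := ucomp (mmu T X) (fmor T i).
have bar_eta : ucomp bar (meta T Y) = i.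
  by rewrite /bar -ucomp_assoc eta_nat ucomp_assoc mmu_etaT ucomp_idl.
have bar_r : ucomp bar (fmor T r) = vid (T X).
  by rewrite /bar -ucomp_assoc -fmor_comp ir mmu_Teta.
have Tri : ucomp (fmor T r) i = meta T Y.
  have [_ pb] := rd _ _ _ (completeSeparated_eta_closed SigT PY).
  (* Since meta T Y . r = T r . i . r, the pair (r, T r . i) is a lifting
     problem for [r] against [meta T Y]; testing the pullback on the unit
     object gives a solution u : Y -> Y in the underlying category. *)
  have [|u [[_ eu] _]] := pb unitI r (ucomp (fmor T r) i).
    by rewrite post_mor pre_mor -ucomp_assoc ir eta_nat.
  rewrite post_mor in eu.
  have iu : ucomp i u = i.
    by rewrite -{1}bar_eta -ucomp_assoc eu ucomp_assoc bar_r ucomp_idl.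
  have u1 : u = vid Y.
    apply: (proj2 EMp _ _ _ (proj2 ic) Y).
    by rewrite !post_mor iu ucomp_idr.
  by rewrite -eu u1 ucomp_idr.
exists bar; split=> //=.
rewrite /bar ucomp_assoc -(vnat_mor (mmu T)) -ucomp_assoc.
have -> : fmor (vfun_comp T T) r = fmor T (fmor T r).
  by rewrite /fmor /fhom /= -comp_assoc.
by rewrite -fmor_comp Tri mmu_Teta.
Qed.

End Reflection.

Theorem theorem6p20 (V : SMCCategory) (B : VCategory V) (T : VMonad B)
  (E M : MorClass B)
  (EM_prefact : VPrefactorizationSystem E M)
  (EM_proper : VProper E M)
  (Sigma : MorClass B)
  (Sigma_inverted : mc_sub Sigma (SigmaT T))
  (factorizations : forall (X Y : B) (f : Mor X Y),
     exists (Z : B) (d : Mor X Z) (c : Mor Z Y),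
       SigmaDense M Sigma d /\ SigmaClosedEmb M Sigma c /\ ucomp c d = f)
  (K : B -> B)
  (r : forall X : B, Mor X (K X))
  (i : forall X : B, Mor (K X) (T X))
  (r_dense : forall X : B, SigmaDense M Sigma (r X))
  (i_closed : forall X : B, SigmaClosedEmb M Sigma (i X))
  (eta_fact : forall X : B, ucomp (i X) (r X) = meta T X) :
  exhibit_V_reflective (CompleteSeparated T M Sigma) r.
Proof.
apply: reflective_of_universal_arrows.
- exact: (completeSeparated_replete EM_prefact EM_proper).
- by move=> X; apply: (closed_in_T_completeSeparated EM_prefact EM_proper
                         Sigma_inverted (i_closed X)).
- move=> X C PC.
  apply: (pullback_iso (r_dense X _ _ _
            (completeSeparated_eta_closed Sigma_inverted PC))).
  apply: pre_iso_of_SigmaT.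
  exact: (dense_factor_inverted EM_prefact EM_proper Sigma_inverted
            (r_dense X) (i_closed X) (eta_fact X)).
Qed.
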